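(* The functor $\mathcal{P}_p^{oe}:\mathbf{RiOp}\to\mathbf{ET}$, the composite of the full inclusion $\mathbf{RiOp}\to\mathbf{SOp}$ of rigid operads into symmetric operads with the functor $\mathcal{P}_a^{oe}:\mathbf{SOp}\to\mathbf{ET}$, is faithful, full on isomorphisms (every isomorphism $\mathcal{P}_p^{oe}(\mathcal{O})\to\mathcal{P}_p^{oe}(\mathcal{O}')$ in $\mathbf{ET}$ is of the form $\mathcal{P}_p^{oe}(h)$ for an isomorphism $h$), and its essential image is the category $\mathbf{RiET}$ of rigid theories (and linear-regular interpretations).
   Context: 'The essential image of a functor $F$ is the (not necessarily full) replete subcategory $\mathbf{D}$' means that $F$ factorizes as a functor onto $\mathbf{D}$, full and essentially surjective on objects, followed by the inclusion of $\mathbf{D}$. Symmetric operads. A symmetric operad $\mathcal{O}$ consists of sets $\mathcal{O}_n$ ($n\in\omega$), a unit $\iota\in\mathcal{O}_1$, compositions $\ast:\mathcal{O}_{n_1}\times\dots\times\mathcal{O}_{n_k}\times\mathcal{O}_k\to\mathcal{O}_n$ with $n=\sum_i n_i$, written $\langle f_1,\dots,f_k\rangle\ast f$, and left actions $\cdot:S_n\times\mathcal{O}_n\to\mathcal{O}_n$, such that composition is associative with unit $\iota$ and compatible with the actions: $\langle\sigma_1\cdot f_1,\dots,\sigma_k\cdot f_k\rangle\ast(\tau\cdot f)=(\langle\sigma_1,\dots,\sigma_k\rangle\star\tau)\cdot(\langle f_{\tau(1)},\dots,f_{\tau(k)}\rangle\ast f)$, where $\langle\sigma_1,\dots,\sigma_k\rangle\star\tau:\sum_i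 n_{\tau(i)}\to\sum_i n_i$ is $\langle i,r\rangle\mapsto\langle\tau(i),\sigma_{\tau(i)}(r)\rangle$ (lexicographic orders). Morphisms preserve arities, unit, compositions and actions. The category is $\mathbf{SOp}$. The category $\mathbf{RiOp}$ of rigid operads is (identified with) the full subcategory of $\mathbf{SOp}$ on the operads for which all actions of the symmetric groups are free. Equational theories. An equational theory is a pair $T=(L,A)$, where $L=\bigcup_n L_n$ ($L_n$ the set of $n$-ary function symbols, disjoint for different $n$) and $A$ is a set of equations in context $t=s:\vec{x}^n$, where $t,s$ are $L$-terms whose variables are among $\vec{x}^n=\langle x_1,\dots,x_n\rangle$. $A\vdash$ denotes provability in equational logic of equations in context. An interpretation $I:(L,A)\to(L',A')$ assigns to each $f\in L_n$ an $L'$-term $I(f):\vec{x}^n$ in such a way that the extension $\bar I$ to terms, $\bar I(x_i)=x_i$, $\bar I(f(t_1,\dots,t_k))=I(f)(x_1\backslash\bar I(t_1),\dots,x_k\backslash\bar I(t_k))$ (simultaneous substitution), satisfies $A'\vdash\bar I(t)=\bar I(s):\vec{x}^n$ for each $t=s:\vec{x}^n$ in $A$. Two interpretations $I,I'$ are identified if $A'\vdash I(f)=I'(f):\vec{x}^n$ for all $n$ and $f\in L_n$. This gives the category $\mathbf{ET}$. A term in context $t:\vec{x}^n$ is linear-regular if each of $x_1,\dots,x_n$ occurs in $t$ exactly once; an equation in context is linear-regular if both its sides are. A theory is linear-regular if every equation that is a consequence of it is a consequence of the set of its linear-regular consequences. An interpretation is linear-regular if it interprets function symbols as linear-regular terms.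 $\mathbf{LrET}$ is the subcategory of $\mathbf{ET}$ of linear-regular theories and linear-regular interpretations. A theory $T=(L,A)$ is rigid if it is linear-regular and for every linear-regular $t:\vec{x}^n$ and $\tau\in S_n$, $A\vdash t=\tau\cdot t:\vec{x}^n$ implies $\tau=\mathrm{id}$, where $\tau\cdot t$ is obtained from $t$ by replacing each $x_i$ by $x_{\tau(i)}$. $\mathbf{RiET}$ is the full subcategory of $\mathbf{LrET}$ on rigid theories. The functor $\mathcal{P}_a^{oe}$. For a symmetric operad $\mathcal{O}$, $\mathcal{P}_a^{oe}(\mathcal{O})=(L,A)$ with $L_n=\mathcal{O}_n$ and $A$ consisting of the equations: (1) $\iota(x_1)=x_1:\vec{x}^1$; (2) $f(f_1(x_1,\dots,x_{k_1}),\dots,f_m(x_{k_1+\dots+k_{m-1}+1},\dots,x_k))=(\langle f_1,\dots,f_m\rangle\ast f)(x_1,\dots,x_k):\vec{x}^k$ for $f\in\mathcal{O}_m$, $f_i\in\mathcal{O}_{k_i}$, $k=\sum_{i=1}^m k_i$; (3) $f(x_{\sigma(1)},\dots,x_{\sigma(n)})=(\sigma\cdot f)(x_1,\dots,x_n):\vec{x}^n$ for $f\in\mathcal{O}_n$, $\sigma\in S_n$. For a morphism $h:\mathcal{O}\to\mathcal{O}'$, $\mathcal{P}_a^{oe}(h)$ is the interpretation sending $f\in\mathcal{O}_n$ to $h(f)(x_1,\dots,x_n):\vec{x}^n$. *)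

(* Defs.v *)
From mathcomp Require Import all_boot all_order all_fingroup.

Set Implicit Arguments.
Unset Strict Implicit.
Unset Printing Implicit Defensive.

(*  Hom-sets are setoids: [heq] is equality of morphisms, so                  *)
(*  that interpretations can be identified up to provable equality without    *)
(*  forming quotients.                                                        *)

Record category := Category {
  obj :> Type;
  hom : obj -> obj -> Type;
  heq : forall X Y : obj, hom X Y -> hom X Y -> Prop;
  idm : forall X : obj, hom X X;
  comp : forall X Y Z : obj, hom Y Z -> hom X Y -> hom X Z;
  heq_refl : forall X Y (f : hom X Y), heq f f;
  heq_sym : forall X Y (f g : hom X Y), heq f g -> heq g f;
  heq_trans : forall X Y (f g h : hom X Y), heq f g -> heq g h -> heq f h;
  comp_heq : forall X Y Z (g g' : hom Y Z) (f f' : hom X Y),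
    heq g g' -> heq f f' -> heq (comp g f) (comp g' f');
  comp_idl : forall X Y (f : hom X Y), heq (comp (idm Y) f) f;
  comp_idr : forall X Y (f : hom X Y), heq (comp f (idm X)) f;
  comp_assoc : forall X Y Z W (h : hom Z W) (g : hom Y Z) (f : hom X Y),
    heq (comp h (comp g f)) (comp (comp h g) f)
}.

Arguments hom {_} _ _.
Arguments heq {_ _ _} _ _.
Arguments idm {_} _.
Arguments comp {_ _ _ _} _ _.

Definition is_iso (C : category) (X Y : C) (f : hom X Y) : Prop :=
  exists g : hom Y X, heq (comp g f) (idm X) /\ heq (comp f g) (idm Y).

Record functor (C D : category) := Functor {
  fobj :> C -> D;
  fmor : forall X Y : C, hom X Y -> hom (fobj X) (fobj Y);
  fmor_heq : forall X Y (f g : hom X Y), heq f g -> heq (fmor f) (fmor g);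
  fmor_id : forall X, heq (fmor (idm X)) (idm (fobj X));
  fmor_comp : forall X Y Z (g : hom Y Z) (f : hom X Y),
    heq (fmor (comp g f)) (comp (fmor g) (fmor f))
}.

Arguments fmor {_ _} _ {_ _} _.

Definition faithful (C D : category) (F : functor C D) : Prop :=
  forall (X Y : C) (f g : hom X Y), heq (fmor F f) (fmor F g) -> heq f g.

Definition full (C D : category) (F : functor C D) : Prop :=
  forall (X Y : C) (g : hom (F X) (F Y)),
    exists f : hom X Y, heq (fmor F f) g.

Definition full_on_isos (C D : category) (F : functor C D) : Prop :=
  forall (X Y : C) (g : hom (F X) (F Y)), is_iso g ->
    exists f : hom X Y, is_iso f /\ heq (fmor F f) g.

Definition essentially_surjective (C D : category) (F : functor C D) : Prop :=
  forall Y : D, exists (X : C) (f : hom (F X) Y), is_iso f.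

Lemma functor_comp_heq (C D E : category) (G : functor D E) (F : functor C D)
    (X Y : C) (f g : hom X Y) :
  heq f g -> heq (fmor G (fmor F f)) (fmor G (fmor F g)).
Proof. by move=> fg; do 2!apply: fmor_heq. Qed.

Lemma functor_comp_id (C D E : category) (G : functor D E) (F : functor C D)
    (X : C) : heq (fmor G (fmor F (idm X))) (idm (G (F X))).
Proof. exact: (heq_trans (fmor_heq G (fmor_id F X)) (fmor_id G _)). Qed.

Lemma functor_comp_comp (C D E : category) (G : functor D E) (F : functor C D)
    (X Y Z : C) (g : hom Y Z) (f : hom X Y) :
  heq (fmor G (fmor F (comp g f)))
      (comp (fmor G (fmor F g)) (fmor G (fmor F f))).
Proof.
exact: (heq_trans (fmor_heq G (fmor_comp F g f)) (fmor_comp G _ _)).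
Qed.

Definition functor_comp (C D E : category) (G : functor D E)
    (F : functor C D) : functor C E :=
  Functor (@functor_comp_heq C D E G F) (@functor_comp_id C D E G F)
    (@functor_comp_comp C D E G F).

Definition hom_cast (C : category) (X X' Y Y' : C) (eX : X = X') (eY : Y = Y')
    (f : hom X Y) : hom X' Y' :=
  ecast Y (hom X' Y) eY (ecast X (hom X Y) eX f).

Definition functor_eq (C D : category) (F G : functor C D) : Prop :=
  exists e : forall X, F X = G X,
  forall (X Y : C) (f : hom X Y),
    heq (hom_cast (e X) (e Y) (fmor F f)) (fmor G f).

(* Not necessarily full.  [smor f] is only meaningful when both ends of f     *)
(* satisfy [sobj].                                                            *)
Record subcategory (C : category) := Subcategory {
  sobj : C -> Prop;
  smor : forall X Y : C, hom X Y -> Prop;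
  smor_heq : forall X Y (f g : hom X Y), heq f g -> smor f -> smor g;
  smor_id : forall X, sobj X -> smor (idm X);
  smor_comp : forall X Y Z (g : hom Y Z) (f : hom X Y),
    sobj X -> sobj Y -> sobj Z -> smor g -> smor f -> smor (comp g f)
}.

Arguments sobj {_} _ _.
Arguments smor {_} _ {_ _} _.

Section SubcategoryAsCategory.
Variables (C : category) (D : subcategory C).

Record sub_obj := SubObj { sub_objval : C; sub_objP : sobj D sub_objval }.

Record sub_hom (X Y : sub_obj) := SubHom {
  sub_homval : hom (sub_objval X) (sub_objval Y);
  sub_homP : smor D sub_homval
}.

Definition sub_heq (X Y : sub_obj) (f g : sub_hom X Y) : Prop :=
  heq (sub_homval f) (sub_homval g).

Definition sub_id (X : sub_obj) : sub_hom X X :=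
  SubHom (smor_id (sub_objP X)).

Definition sub_comp (X Y Z : sub_obj) (g : sub_hom Y Z) (f : sub_hom X Y) :
    sub_hom X Z :=
  SubHom (smor_comp (sub_objP X) (sub_objP Y) (sub_objP Z)
                    (sub_homP g) (sub_homP f)).

Definition subcat : category :=
  @Category sub_obj sub_hom sub_heq sub_id sub_comp
    (fun X Y f => heq_refl _) (fun X Y f g => @heq_sym _ _ _ _ _)
    (fun X Y f g h => @heq_trans _ _ _ _ _ _)
    (fun X Y Z g g' f f' => @comp_heq _ _ _ _ _ _ _ _)
    (fun X Y f => comp_idl _) (fun X Y f => comp_idr _)
    (fun X Y Z W h g f => comp_assoc _ _ _).

Definition incl : functor subcat C :=
  @Functor subcat C sub_objval sub_homval (fun X Y f g fg => fg)
    (fun X => heq_refl _) (fun X Y Z g f => heq_refl _).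

End SubcategoryAsCategory.

Definition full_subcategory (C : category) (P : C -> Prop) : subcategory C :=
  @Subcategory C P (fun _ _ _ => True) (fun _ _ _ _ _ _ => I) (fun _ _ => I)
    (fun _ _ _ _ _ _ _ _ _ _ => I).

(* The full subcategory of D, again as a subcategory of C, on the objects of  *)
(* D satisfying P.                                                            *)
Definition full_subcategory_in (C : category) (D : subcategory C)
    (P : C -> Prop) : subcategory C :=
  @Subcategory C (fun X => sobj D X /\ P X) (fun X Y f => smor D f)
    (@smor_heq C D) (fun X DX => smor_id DX.1)
    (fun X Y Z g f DX DY DZ => smor_comp DX.1 DY.1 DZ.1).

(* The essential image is defined by the factorization alone.  Closure of the *)
(* objects of D under all isomorphisms of E is not part of it: rigidity of a  *)
(* theory depends on its presentation and is not invariant under isomorphism  *)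
(* in the category of all theories.  G is essentially surjective with respect *)
(* to isomorphisms of D itself.                                               *)
Definition essential_image_is (C E : category) (F : functor C E)
    (D : subcategory E) : Prop :=
  exists G : functor C (subcat D),
    [/\ full G, essentially_surjective G
      & functor_eq F (functor_comp (incl D) G)].

(*  Indices are shifted to 'I_n = {0, ..., n-1}, and the                      *)
(*  lexicographically ordered sum of the 'I_(n i) is coded in                 *)
(*  'I_(\sum_i n i) by tagnat.Rank / tagnat.sig1 / tagnat.sig2.               *)

Section BlockPermutation.
Variables (k : nat) (n : 'I_k -> nat).
Variables (sigma : forall i, 'S_(n i)) (tau : 'S_k).

Lemma sum_perm_eq : \sum_(i < k) n i = \sum_(i < k) n (tau i).
Proof. by rewrite (reindex_inj (@perm_inj _ tau)). Qed.

(* <i, r> |-> <tau i, sigma_(tau i) r>.  The target \sum_i n i of this        *)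
(* bijection is identified with its source \sum_i n (tau i), the two numbers  *)
(* being equal, so as to get a permutation.                                   *)
Definition block_fun (p : 'I_(\sum_(i < k) n (tau i))) :
    'I_(\sum_(i < k) n (tau i)) :=
  let i := tagnat.sig1 p in
  cast_ord sum_perm_eq (tagnat.Rank (tau i) (sigma (tau i) (tagnat.sig2 p))).

Lemma block_fun_inj : injective block_fun.
Proof.
move=> p q /cast_ord_inj; rewrite /tagnat.Rank => /tagnat.rank_inj.
rewrite -(tagnat.sigK p) -(tagnat.sigK q).
rewrite /tagnat.sig1 /tagnat.sig2 !tagnat.rankK.
case: (tagnat.sig p) (tagnat.sig q) => [i r] [j s] /= e.
have ij : i = j by have /= /perm_inj := congr1 (fun x => tag x) e.
case: j / ij s e => s e; congr (tagnat.rank _).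
by move/eqP: e; rewrite eq_Tagged /= => /eqP/perm_inj->.
Qed.

Definition block_perm : 'S_(\sum_(i < k) n (tau i)) := perm block_fun_inj.

End BlockPermutation.

(* [ocomp fs f] is <fs 0, ..., fs (k-1)> * f.  Equations whose two sides have *)
(* provably but not definitionally equal arities are stated in the disjoint   *)
(* union {n : nat & op n}.  In MathComp (tau * sigma)%g i = sigma (tau i), so *)
(* [oact_comp] says that the action is a left action for the usual            *)
(* composition of functions.                                                  *)
Record operad := Operad {
  op :> nat -> Type;
  ounit : op 1;
  ocomp : forall (k : nat) (n : 'I_k -> nat),
    (forall i, op (n i)) -> op k -> op (\sum_(i < k) n i);
  oact : forall n : nat, 'S_n -> op n -> op n;
  ocomp_unitl : forall n (f : op n),
    Tagged op (ocomp (fun _ : 'I_n => ounit) f) = Tagged op f;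
  ocomp_unitr : forall n (f : op n),
    Tagged op (ocomp (fun _ : 'I_1 => f) ounit) = Tagged op f;
  ocomp_assoc : forall k (m : 'I_k -> nat) (n : forall i, 'I_(m i) -> nat)
      (g : forall i j, op (n i j)) (f : forall i, op (m i)) (h : op k),
    Tagged op (ocomp (fun i => ocomp (g i) (f i)) h) =
    Tagged op (ocomp (fun p => g (tagnat.sig1 p) (tagnat.sig2 p)) (ocomp f h));
  oact_id : forall n (f : op n), oact 1%g f = f;
  oact_comp : forall n (sigma tau : 'S_n) (f : op n),
    oact sigma (oact tau f) = oact (tau * sigma)%g f;
  oact_ocomp : forall k (n : 'I_k -> nat) (sigma : forall i, 'S_(n i))
      (tau : 'S_k) (fs : forall i, op (n i)) (f : op k),
    Tagged op (ocomp (fun i => oact (sigma i) (fs i)) (oact tau f)) =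
    Tagged op (oact (block_perm sigma tau) (ocomp (fun i => fs (tau i)) f))
}.

Arguments ounit {_}.
Arguments ocomp {_ _ _} _ _.
Arguments oact {_ _} _ _.

Record operad_hom (O O' : operad) := OperadHom {
  ofun :> forall n, O n -> O' n;
  ofun_unit : ofun (@ounit O) = ounit;
  ofun_comp : forall k (n : 'I_k -> nat) (fs : forall i, O (n i)) (f : O k),
    ofun (ocomp fs f) = ocomp (fun i => ofun (fs i)) (ofun f);
  ofun_act : forall n (sigma : 'S_n) (f : O n),
    ofun (oact sigma f) = oact sigma (ofun f)
}.

Definition operad_heq (O O' : operad) (h h' : operad_hom O O') : Prop :=
  forall n (f : O n), h n f = h' n f.

Definition operad_id (O : operad) : operad_hom O O :=
  @OperadHom O O (fun _ f => f) erefl (fun _ _ _ _ => erefl)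
    (fun _ _ _ => erefl).

Section OperadComp.
Variables (O1 O2 O3 : operad) (h' : operad_hom O2 O3) (h : operad_hom O1 O2).

Lemma operad_comp_unit : h' _ (h _ ounit) = ounit.
Proof. by rewrite !ofun_unit. Qed.

Lemma operad_comp_comp k (n : 'I_k -> nat) (fs : forall i, O1 (n i))
    (f : O1 k) :
  h' _ (h _ (ocomp fs f)) = ocomp (fun i => h' _ (h _ (fs i))) (h' _ (h _ f)).
Proof. by rewrite !ofun_comp. Qed.

Lemma operad_comp_act n (sigma : 'S_n) (f : O1 n) :
  h' _ (h _ (oact sigma f)) = oact sigma (h' _ (h _ f)).
Proof. by rewrite !ofun_act. Qed.

Definition operad_comp : operad_hom O1 O3 :=
  @OperadHom O1 O3 (fun n f => h' n (h n f)) operad_comp_unit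
    operad_comp_comp operad_comp_act.

End OperadComp.

Lemma operad_comp_heq (O1 O2 O3 : operad) (g g' : operad_hom O2 O3)
    (f f' : operad_hom O1 O2) :
  operad_heq g g' -> operad_heq f f' ->
  operad_heq (operad_comp g f) (operad_comp g' f').
Proof. by move=> gg' ff' n x; rewrite /= ff' gg'. Qed.

Definition SOp : category :=
  @Category operad operad_hom operad_heq operad_id operad_comp
    (fun _ _ _ _ _ => erefl) (fun _ _ _ _ e n x => esym (e n x))
    (fun _ _ _ _ _ e e' n x => etrans (e n x) (e' n x))
    operad_comp_heq
    (fun _ _ _ _ _ => erefl) (fun _ _ _ _ _ => erefl)
    (fun _ _ _ _ _ _ _ _ _ => erefl).

Definition rigid_operad (O : operad) : Prop :=
  forall n (f : O n) (sigma : 'S_n), oact sigma f = f -> sigma = 1%g.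

Definition RiOp_in_SOp : subcategory SOp :=
  @full_subcategory SOp rigid_operad.

Definition RiOp : category := subcat RiOp_in_SOp.

(*  [term L n] is the set of terms in context                                 *)
(*  t : x_1, ..., x_n, and L n the set of n-ary function symbols.             *)

Inductive term (L : nat -> Type) (n : nat) : Type :=
  | Var of 'I_n
  | App k of L k & ('I_k -> term L n).

Arguments Var {L n} _.
Arguments App {L n k} _ _.

Fixpoint subst (L : nat -> Type) (n m : nat) (s : 'I_n -> term L m)
    (t : term L n) : term L m :=
  match t with
  | Var i => s i
  | App _ f a => App f (fun j => subst s (a j))
  end.

Definition equations (L : nat -> Type) := forall n, term L n -> term L n -> Prop.

Inductive provable (L : nat -> Type) (A : equations L) : equations L :=
  | prov_ax n (t u : term L n) : A n t u -> provable A t u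
  | prov_refl n (t : term L n) : provable A t t
  | prov_sym n (t u : term L n) : provable A t u -> provable A u t
  | prov_trans n (t u v : term L n) :
      provable A t u -> provable A u v -> provable A t v
  | prov_app n k (f : L k) (a b : 'I_k -> term L n) :
      (forall i, provable A (a i) (b i)) -> provable A (App f a) (App f b)
  | prov_subst n m (s : 'I_n -> term L m) (t u : term L n) :
      provable A t u -> provable A (subst s t) (subst s u).

Record theory := Theory {
  symb : nat -> Type;
  axiom_of : equations symb
}.

Arguments axiom_of _ {_} _ _.

Notation "T |- t =~ u" := (provable (@axiom_of T) t u)
  (at level 70, t at level 65, u at level 65).

Fixpoint extend (L L' : nat -> Type) (I : forall k, L k -> term L' k) (n : nat)
    (t : term L n) : term L' n :=
  match t with
  | Var i => Var i
  | App _ f a => subst (fun j => extend I (a j)) (I _ f)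
  end.

Record interpretation (T T' : theory) := Interpretation {
  ifun :> forall n, symb T n -> term (symb T') n;
  ifunP : forall n (t u : term (symb T) n),
    axiom_of T t u -> T' |- extend ifun t =~ extend ifun u
}.

Definition interp_heq (T T' : theory) (I I' : interpretation T T') : Prop :=
  forall n (f : symb T n), T' |- I n f =~ I' n f.

Section EquationalLogic.

Lemma prov_subst_pointwise L (A : equations L) n m (s s' : 'I_n -> term L m)
    (t : term L n) :
  (forall i, provable A (s i) (s' i)) -> provable A (subst s t) (subst s' t).
Proof.
by move=> ss'; elim: t => [i|k f a IHa] /=; [exact: ss' | exact: prov_app].
Qed.

Lemma prov_subst2 L (A : equations L) n m (s s' : 'I_n -> term L m)
    (t t' : term L n) :
  (forall i, provable A (s i) (s' i)) -> provable A t t' ->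
  provable A (subst s t) (subst s' t').
Proof.
move=> ss' tt'; apply: prov_trans (prov_subst s tt') _.
exact: prov_subst_pointwise.
Qed.

(* Function extensionality is avoided by working up to provability from any   *)
(* set of axioms.                                                             *)
Lemma prov_subst_subst L (A : equations L) n m p (s : 'I_n -> term L m)
    (s' : 'I_m -> term L p) (t : term L n) :
  provable A (subst s' (subst s t)) (subst (fun i => subst s' (s i)) t).
Proof.
by elim: t => [i|k f a IHa] /=; [exact: prov_refl | exact: prov_app].
Qed.

Lemma prov_subst_var L (A : equations L) n (t : term L n) :
  provable A (subst Var t) t.
Proof.
by elim: t => [i|k f a IHa] /=; [exact: prov_refl | exact: prov_app].
Qed.

Lemma prov_extend_subst L L' (A : equations L')
    (I : forall k, L k -> term L' k) n m (s : 'I_n -> term L m) (t : term L n) :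
  provable A (extend I (subst s t)) (subst (fun i => extend I (s i)) (extend I t)).
Proof.
elim: t => [i|k f a IHa] /=; first exact: prov_refl.
apply: prov_trans (prov_sym (prov_subst_subst _ _ _ _)).
exact: prov_subst_pointwise.
Qed.

Lemma prov_extend (T T' : theory) (I : interpretation T T') n
    (t u : term (symb T) n) :
  T |- t =~ u -> T' |- extend I t =~ extend I u.
Proof.
elim=> {n t u}
  [n t u /ifunP //|n t|n t u _|n t u v _ IH1 _ IH2|n k f a b _ IH|n m s t u _ IH].
- exact: prov_refl.
- exact: prov_sym.
- exact: prov_trans IH1 IH2.
- exact: prov_subst_pointwise.
- apply: prov_trans (prov_extend_subst _ _ _ _) _.
  apply: prov_trans (prov_subst _ IH) _.
  exact: prov_sym (prov_extend_subst _ _ _ _).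
Qed.

Lemma prov_extend_heq L L' (A : equations L') (I I' : forall k, L k -> term L' k)
    n (t : term L n) :
  (forall k f, provable A (I k f) (I' k f)) ->
  provable A (extend I t) (extend I' t).
Proof.
move=> II'; elim: t => [i|k f a IHa] /=; first exact: prov_refl.
exact: prov_subst2.
Qed.

Lemma prov_extend_id L (A : equations L) n (t : term L n) :
  provable A (extend (fun k f => App f Var) t) t.
Proof.
by elim: t => [i|k f a IHa] /=; [exact: prov_refl | exact: prov_app].
Qed.

Lemma prov_extend_extend L L' L'' (A : equations L'')
    (J : forall k, L' k -> term L'' k) (I : forall k, L k -> term L' k)
    n (t : term L n) :
  provable A (extend (fun k f => extend J (I k f)) t) (extend J (extend I t)).
Proof.
elim: t => [i|k f a IHa] /=; first exact: prov_refl.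
apply: prov_trans (prov_sym (prov_extend_subst _ _ _ _)).
exact: prov_subst_pointwise.
Qed.

End EquationalLogic.

Lemma interp_idP (T : theory) n (t u : term (symb T) n) : axiom_of T t u ->
  T |- extend (fun k f => App f Var) t =~ extend (fun k f => App f Var) u.
Proof.
move=> tu; apply: prov_trans (prov_extend_id _ _) _.
exact: prov_trans (prov_ax tu) (prov_sym (prov_extend_id _ _)).
Qed.

Definition interp_id (T : theory) : interpretation T T :=
  Interpretation (@interp_idP T).

Section InterpComp.
Variables (T1 T2 T3 : theory).
Variables (J : interpretation T2 T3) (I : interpretation T1 T2).

Lemma interp_compP n (t u : term (symb T1) n) : axiom_of T1 t u ->
  T3 |- extend (fun k f => extend J (I k f)) t
     =~ extend (fun k f => extend J (I k f)) u.
Proof.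
move=> tu; apply: prov_trans (prov_extend_extend _ _ _ _) _.
apply: prov_trans (prov_sym (prov_extend_extend _ _ _ _)).
exact: prov_extend (ifunP I tu).
Qed.

Definition interp_comp : interpretation T1 T3 := Interpretation interp_compP.

End InterpComp.

Lemma interp_comp_heq (T1 T2 T3 : theory) (J J' : interpretation T2 T3)
    (I I' : interpretation T1 T2) :
  interp_heq J J' -> interp_heq I I' ->
  interp_heq (interp_comp J I) (interp_comp J' I').
Proof.
move=> JJ' II' n f /=; apply: prov_trans (prov_extend J (II' n f)) _.
exact: prov_extend_heq.
Qed.

Lemma interp_comp_idl (T1 T2 : theory) (I : interpretation T1 T2) :
  interp_heq (interp_comp (interp_id T2) I) I.
Proof. by move=> n f; exact: prov_extend_id. Qed.

Lemma interp_comp_idr (T1 T2 : theory) (I : interpretation T1 T2) :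
  interp_heq (interp_comp I (interp_id T1)) I.
Proof. by move=> n f; exact: prov_subst_var. Qed.

Lemma interp_comp_assoc (T1 T2 T3 T4 : theory) (K : interpretation T3 T4)
    (J : interpretation T2 T3) (I : interpretation T1 T2) :
  interp_heq (interp_comp K (interp_comp J I))
             (interp_comp (interp_comp K J) I).
Proof. by move=> n f; exact: prov_sym (prov_extend_extend _ _ _ _). Qed.

Definition ET : category :=
  @Category theory interpretation interp_heq interp_id interp_comp
    (fun _ _ _ _ _ => prov_refl _ _) (fun _ _ _ _ e n f => prov_sym (e n f))
    (fun _ _ _ _ _ e e' n f => prov_trans (e n f) (e' n f))
    interp_comp_heq interp_comp_idl interp_comp_idr interp_comp_assoc.

Fixpoint occurrences (L : nat -> Type) (n : nat) (i : 'I_n) (t : term L n) :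
    nat :=
  match t with
  | Var j => i == j
  | App k _ a => \sum_(j < k) occurrences i (a j)
  end.

Definition linear_regular_term L n (t : term L n) : Prop :=
  forall i : 'I_n, occurrences i t = 1.

Definition linear_regular_consequences (T : theory) : equations (symb T) :=
  fun n t u =>
    [/\ T |- t =~ u, linear_regular_term t & linear_regular_term u].

Definition linear_regular_theory (T : theory) : Prop :=
  forall n (t u : term (symb T) n),
    T |- t =~ u -> provable (@linear_regular_consequences T) t u.

Definition linear_regular_interp (T T' : theory) (I : interpretation T T') :
    Prop :=
  forall n (f : symb T n), linear_regular_term (I n f).

Lemma occurrences_subst L n m (s : 'I_n -> term L m) (t : term L n)
    (i : 'I_m) :
  occurrences i (subst s t) =
  \sum_(j < n) occurrences j t * occurrences i (s j).
Proof.
elim: t => [j|k f a IHa] /=.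
  rewrite (bigD1 j) //= eqxx mul1n big1 ?addn0 // => j' j'j.
  by rewrite (negPf j'j) mul0n.
rewrite (eq_bigr _ (fun j _ => IHa j)) exchange_big /=.
by apply: eq_bigr => j _; rewrite big_distrl.
Qed.

Lemma occurrences_extend L L' (I : forall k, L k -> term L' k) n
    (t : term L n) (i : 'I_n) :
  (forall k f, linear_regular_term (I k f)) ->
  occurrences i (extend I t) = occurrences i t.
Proof.
move=> lrI; elim: t => [j|k f a IHa] //=.
rewrite occurrences_subst; apply: eq_bigr => j _.
by rewrite lrI mul1n IHa.
Qed.

Lemma linear_regular_app L n (f : L n) :
  linear_regular_term (App f Var : term L n).
Proof.
move=> i /=; rewrite (bigD1 i) //= eqxx big1 // => j ji.
by rewrite eq_sym (negPf ji).
Qed.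

(* A morphism of ET is linear-regular when it is represented by a linear-     *)
(* regular interpretation.                                                    *)
Definition linear_regular_mor (T T' : theory) (I : interpretation T T') :
    Prop :=
  exists2 J : interpretation T T', interp_heq I J & linear_regular_interp J.

Lemma linear_regular_mor_heq (T T' : theory) (I I' : interpretation T T') :
  interp_heq I I' -> linear_regular_mor I -> linear_regular_mor I'.
Proof.
move=> II' [J IJ lrJ]; exists J => // n f.
exact: prov_trans (prov_sym (II' n f)) (IJ n f).
Qed.

Lemma linear_regular_mor_id (T : theory) : linear_regular_mor (interp_id T).
Proof.
exists (interp_id T) => n f; first exact: prov_refl.
exact: linear_regular_app.
Qed.

Lemma linear_regular_mor_comp (T1 T2 T3 : theory) (J : interpretation T2 T3)
    (I : interpretation T1 T2) :
  linear_regular_mor J -> linear_regular_mor I ->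
  linear_regular_mor (interp_comp J I).
Proof.
move=> [J' JJ' lrJ] [I' II' lrI]; exists (interp_comp J' I').
  exact: interp_comp_heq.
by move=> n f i; rewrite /= occurrences_extend //; exact: lrI.
Qed.

Definition LrET_in_ET : subcategory ET :=
  @Subcategory ET linear_regular_theory linear_regular_mor
    linear_regular_mor_heq (fun T _ => linear_regular_mor_id T)
    (fun T1 T2 T3 J I _ _ _ => @linear_regular_mor_comp T1 T2 T3 J I).

Definition perm_term L n (tau : 'S_n) (t : term L n) : term L n :=
  subst (fun i => Var (tau i)) t.

Definition rigid_theory (T : theory) : Prop :=
  linear_regular_theory T /\
  forall n (t : term (symb T) n) (tau : 'S_n),
    linear_regular_term t -> T |- t =~ perm_term tau t -> tau = 1%g.

Definition RiET_in_ET : subcategory ET :=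
  full_subcategory_in LrET_in_ET rigid_theory.

Inductive operad_axiom (O : operad) : equations O :=
  | oax_unit :
      operad_axiom (App (@ounit O) (fun i : 'I_1 => Var i))
                   (Var (ord0 : 'I_1))
  | oax_comp k (n : 'I_k -> nat) (fs : forall i, O (n i)) (f : O k) :
      @operad_axiom O (\sum_(i < k) n i)
        (App f (fun i => App (fs i) (fun r => Var (tagnat.Rank i r))))
        (App (ocomp fs f) (fun p => Var p))
  | oax_act n (sigma : 'S_n) (f : O n) :
      operad_axiom (App f (fun i => Var (sigma i)))
                   (App (oact sigma f) (fun i => Var i)).

Definition Pa_obj (O : operad) : theory := Theory (@operad_axiom O).

Section PaMor.
Variables (O O' : operad) (h : operad_hom O O').

Lemma Pa_morP n (t u : term O n) : operad_axiom t u ->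
  Pa_obj O' |- extend (fun k f => App (h k f) Var) t
            =~ extend (fun k f => App (h k f) Var) u.
Proof.
case=> {n t u} [|k n fs f|n sigma f] /=.
- by rewrite ofun_unit; apply: prov_ax; exact: oax_unit.
- by rewrite ofun_comp; apply: prov_ax; exact: oax_comp.
- by rewrite ofun_act; apply: prov_ax; exact: oax_act.
Qed.

Definition Pa_mor : interpretation (Pa_obj O) (Pa_obj O') :=
  @Interpretation (Pa_obj O) (Pa_obj O') (fun k f => App (h k f) Var) Pa_morP.

End PaMor.

Lemma Pa_mor_heq (O O' : operad) (h h' : operad_hom O O') :
  operad_heq h h' -> interp_heq (Pa_mor h) (Pa_mor h').
Proof. by move=> hh' n f /=; rewrite hh'; exact: prov_refl. Qed.

Definition Pa : functor SOp ET :=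
  @Functor SOp ET Pa_obj Pa_mor Pa_mor_heq (fun _ _ _ => prov_refl _ _)
    (fun _ _ _ _ _ _ _ => prov_refl _ _).

Definition Pp : functor RiOp ET := functor_comp Pa (incl RiOp_in_SOp).

(* Main.v *)
(* Every term over an operad O flattens to one operation applied to           *)
(* variables, f(x_v(1), ..., x_v(m)), uniquely up to the action of S_m on     *)
(* (f, v); this invariant is sound for P_a(O), so that                        *)
(* f(x_1, ..., x_n) = g(x_1, ..., x_n) is provable only if f = g (whence      *)
(* faithfulness), and linear-regular terms have the form f(x_1, ..., x_n)     *)
(* (whence fullness on linear-regular interpretations).  An isomorphism       *)
(* between theories whose provable equations preserve the number of           *)
(* occurrences of each variable is linear-regular.  Finally, a rigid theory   *)
(* is isomorphic to P_a of the operad of its linear-regular terms modulo      *)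
(* provable equality: flattening in that operad shows that each linear-       *)
(* regular term is provably its own class applied to x_1, ..., x_n.           *)

From mathcomp Require Import all_boot all_order all_fingroup.
From Stdlib Require Import FunctionalExtensionality PropExtensionality.
From Stdlib Require Import ClassicalEpsilon.
Require Import Defs.

Set Implicit Arguments.
Unset Strict Implicit.
Unset Printing Implicit Defensive.

(** Two invariants of provability in [Pa_obj O] carry the proof. First, the flattening of a term to
    f(x_v(1), ..., x_v(m)), up to permuting f and v together, is preserved ([flatten_sound]). When v
    is the identity no permutation is left, so f(x_1, ..., x_n) determines f ([Pa_conservative]);
    this is faithfulness. Second, the number of occurrences of each variable is preserved, since the
    axioms are linear-regular. So in a linear-regular term v is a bijection, which the action
    absorbs into f ([Pa_linear_normal]), and linear-regular interpretations come from operad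
    morphisms ([Pa_full_linear]). An isomorphism can neither drop nor duplicate variables
    ([iso_linear_regular]), hence is one of these. Freeness of the actions makes the theory rigid
    ([Pa_rigid]). Conversely, a rigid theory is isomorphic to the theory of its operad of
    linear-regular terms modulo provability: its linear-regular consequences, which axiomatize it,
    hold there by [symb_op_class]. *)

(** * Index arithmetic of lexicographic sums *)

Lemma Rank_ind k (m : 'I_k -> nat) (P : 'I_(\sum_i m i) -> Prop) :
  (forall i (j : 'I_(m i)), P (tagnat.Rank i j)) -> forall p, P p.
Proof. by move=> PR p; rewrite -(tagnat.sig2K p). Qed.

Lemma ltn_Rank k (m : 'I_k -> nat) i (j : 'I_(m i)) i0 (j0 : 'I_(m i0)) :
  (tagnat.Rank i j < tagnat.Rank i0 j0) = (i < i0) || (i == i0) && (j < j0).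
Proof.
have := @tagnat.lt_rank _ m (Tagged _ j) (Tagged _ j0).
rewrite ltEord => ->; rewrite Order.SigmaOrder.ltEsig /= !leEord -val_eqE /=.
case: ltngtP => //= /val_inj e.
by case: i0 / e j0 => j0; rewrite tagged_asE ltEord.
Qed.

(** Whatever precedes [(i0, j0)] lexicographically lies in an earlier block or earlier in block
    [i0]. With block sizes for [F], both sides are the offset of a block in an iterated sum. *)
Lemma sum_lt_Rank k (m : 'I_k -> nat) (F : forall i, 'I_(m i) -> nat)
    (i0 : 'I_k) (j0 : 'I_(m i0)) :
  \sum_(p < \sum_i m i | p < tagnat.Rank i0 j0)
      F (tagnat.sig1 p) (tagnat.sig2 p) =
  \sum_(i < k | i < i0) \sum_j F i j + \sum_(j < m i0 | j < j0) F i0 j.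
Proof.
rewrite (reindex (@tagnat.rank k m)) /=; last exact: onW_bij tagnat.rank_bij.
rewrite (eq_bigr (fun s => F (tag s) (tagged s))); last first.
  by move=> s _; rewrite /tagnat.sig1 /tagnat.sig2 tagnat.rankK.
rewrite (eq_bigl (fun s : {i & 'I_(m i)} =>
  (tag s < i0) || (tag s == i0) && (tagged s < j0))); last first.
  by case=> i j; rewrite -ltn_Rank.
rewrite (bigID (fun s : {i & 'I_(m i)} => tag s < i0)) /=; congr (_ + _).
  rewrite (sig_big_dep (fun i : 'I_k => i < i0) (fun _ _ => true) F).
  by apply: eq_bigl => -[i j] /=; case: (i < i0); rewrite ?andbF.
transitivity (\sum_(i < k | i == i0) \sum_(j < m i | j < j0) F i j);
  last by rewrite big_pred1_eq.
rewrite (sig_big_dep (fun i : 'I_k => i == i0)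
  (fun i (j : 'I_(m i)) => j < j0) F).
apply: eq_bigl => -[i j] /=.
case: eqP => [e|_]; rewrite ?orbF ?andbN //.
by rewrite [i < i0](_ : _ = false) ?andbT // e ltnn.
Qed.

(** Associativity of lexicographic sums, stated in [nat] because the two ordinals have different
    bounds. *)
Lemma Rank_assoc k (m : 'I_k -> nat) (n : forall i, 'I_(m i) -> nat)
    (p : 'I_(\sum_i m i)) (r : 'I_(n (tagnat.sig1 p) (tagnat.sig2 p))) :
  @tagnat.Rank _ (fun i => \sum_j n i j) (tagnat.sig1 p)
    (@tagnat.Rank _ (n (tagnat.sig1 p)) (tagnat.sig2 p) r) =
  @tagnat.Rank _ (fun q => n (tagnat.sig1 q) (tagnat.sig2 q)) p r :> nat.
Proof.
rewrite !tagnat.RankEsum addnA; congr (_ + _).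
by rewrite -(@sum_lt_Rank _ _ n) tagnat.sig2K.
Qed.

Section Counting.
Variables (m n : nat) (v : 'I_m -> 'I_n).
Hypothesis v_count : forall i, \sum_(j < m) (i == v j) = 1.

Lemma count1_inj : injective v.
Proof.
move=> j j' vj; apply/eqP; apply: contra_eqT (v_count (v j)) => j'j.
by rewrite (bigD1 j) //= (bigD1 j') 1?eq_sym //= vj eqxx.
Qed.

(** Double counting of the pairs [(i, j)] with [i = v j]. *)
Lemma count1_eq : m = n.
Proof.
rewrite -(card_ord n) -sum1_card -(eq_bigr _ (fun i _ => v_count i)).
rewrite exchange_big /= -{1}(card_ord m) -sum1_card.
by apply: eq_bigr => j _; rewrite (bigD1 (v j)) //= eqxx big1 // => i /negPf->.
Qed.

End Counting.

(** * Terms, grafting and occurrence counts *)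

Section Terms.
Variable L : nat -> Type.

Lemma subst_subst n m p (s : 'I_n -> term L m) (s' : 'I_m -> term L p)
    (t : term L n) :
  subst s' (subst s t) = subst (fun i => subst s' (s i)) t.
Proof.
elim: t => [i|k f a IHa] //=; congr App.
exact/functional_extensionality.
Qed.

Lemma subst_var n (t : term L n) : subst Var t = t.
Proof.
elim: t => [i|k f a IHa] //=; congr App.
exact/functional_extensionality.
Qed.

Lemma eq_subst n m (s s' : 'I_n -> term L m) (t : term L n) :
  s =1 s' -> subst s t = subst s' t.
Proof. by move=> /functional_extensionality->. Qed.

Lemma linear_regular_subst n m (s : 'I_n -> term L m) (t : term L n) :
  linear_regular_term t ->
  (forall i, \sum_(j < n) occurrences i (s j) = 1) ->
  linear_regular_term (subst s t).
Proof.
move=> lt ls i; rewrite occurrences_subst -(ls i).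
by apply: eq_bigr => j _; rewrite lt mul1n.
Qed.

Lemma linear_regular_perm n (tau : 'S_n) (t : term L n) :
  linear_regular_term t -> linear_regular_term (perm_term tau t).
Proof.
move=> lt; apply: linear_regular_subst => // i /=.
rewrite (bigD1 (tau^-1%g i)) //= permKV eqxx big1 // => j.
by apply: contraNeq; rewrite eqb0 negbK => /eqP->; rewrite permK.
Qed.

(** The operadic composition of terms: the arguments get disjoint consecutive blocks of
    variables. *)
Definition graft k (n : 'I_k -> nat) (fs : forall i, term L (n i))
    (f : term L k) : term L (\sum_i n i) :=
  subst (fun i => subst (fun r => Var (tagnat.Rank i r)) (fs i)) f.

Lemma sum_Rank_eq1 k (n : 'I_k -> nat) (p : 'I_(\sum_i n i)) :
  \sum_i \sum_(r < n i) (p == tagnat.Rank i r) = 1.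
Proof.
rewrite (sig_big_dep xpredT (fun _ _ => true)
  (fun i (r : 'I_(n i)) => p == tagnat.Rank i r : nat)) /=.
rewrite (bigD1 (tagnat.sig p)) //= -[tagnat.Rank _ _]tagnat.rankE.
rewrite tagnat.sigK eqxx.
rewrite big1 // => s; apply: contraNeq; rewrite eqb0 negbK -tagnat.rankE.
by move=> /eqP->; rewrite tagnat.rankK.
Qed.

Lemma linear_regular_graft k (n : 'I_k -> nat) (fs : forall i, term L (n i))
    (f : term L k) :
  (forall i, linear_regular_term (fs i)) -> linear_regular_term f ->
  linear_regular_term (graft fs f).
Proof.
move=> lfs lf; apply: linear_regular_subst => // p.
rewrite -(sum_Rank_eq1 p); apply: eq_bigr => i _; rewrite occurrences_subst.
by apply: eq_bigr => r _; rewrite lfs mul1n.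
Qed.

Lemma provable_weaken (A B : equations L) n (t u : term L n) :
  (forall n (t u : term L n), A n t u -> provable B t u) ->
  provable A t u -> provable B t u.
Proof.
move=> AB; elim=> {n t u} [n t u /AB //|n t|n t u _|n t u v _ tu _|n k f a b _
  |n m s t u _]; [exact: prov_refl | exact: prov_sym | exact: prov_trans tu
  | exact: prov_app | exact: prov_subst].
Qed.

(** Counts in a substitution instance depend on the term only through its own counts
    ([occurrences_subst]), so every rule of the logic preserves them. *)
Lemma provable_occurrences (A : equations L) n (t u : term L n) :
  (forall n (t u : term L n), A n t u ->
     linear_regular_term t /\ linear_regular_term u) ->
  provable A t u -> forall i, occurrences i t = occurrences i u.
Proof.
move=> lA; elim=> {n t u}
  [n t u /lA[lt lu] i|//|n t u _ IH i|n t u v _ IH1 _ IH2 i|n k f a b _ IH i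
  |n m s t u _ IH i] /=.
- by rewrite lt lu.
- by rewrite IH.
- by rewrite IH1 IH2.
- by apply: eq_bigr => j _; rewrite IH.
- by rewrite !occurrences_subst; apply: eq_bigr => j _; rewrite IH.
Qed.

End Terms.

Lemma Rank_units n (i : 'I_n) (r : 'I_1) :
  @tagnat.Rank n (fun=> 1) i r = i :> nat.
Proof.
rewrite tagnat.RankEsum (ord1 r) addn0.
by rewrite -(big_ord_widen _ (fun=> 1)) ?sum1_card ?card_ord // ltnW.
Qed.

Lemma Rank_single m (i : 'I_1) (r : 'I_m) :
  @tagnat.Rank 1 (fun=> m) i r = r :> nat.
Proof. by rewrite tagnat.RankEsum (ord1 i) big_pred0. Qed.

Lemma block_fun_Rank k (n : 'I_k -> nat) (sigma : forall i, 'S_(n i))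
    (tau : 'S_k) i (r : 'I_(n (tau i))) :
  block_fun sigma (tagnat.Rank i r) =
  cast_ord (sum_perm_eq n tau) (tagnat.Rank (tau i) (sigma (tau i) r)).
Proof.
rewrite /block_fun; congr cast_ord.
(* As a function of the whole tagged pair, [R] lets [rankK] act by congruence, with no dependent
   rewriting. *)
pose R (s : {i & 'I_(n (tau i))}) :=
  tagnat.Rank (tau (tag s)) (sigma (tau (tag s)) (tagged s)).
exact: (congr1 R (tagnat.rankK (Tagged _ r))).
Qed.

Definition preserves_occurrences (T : theory) : Prop :=
  forall n (t u : term (symb T) n), T |- t =~ u ->
  forall i, occurrences i t = occurrences i u.

(** * Flattening of terms over an operad *)

Section Flattening.
Variable O : operad.

(* [Flat f v] stands for the term f(x_v(1), ..., x_v(m)). *)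
Record flat n := Flat { ar : nat; head : O ar; leaf : 'I_ar -> 'I_n }.

Arguments leaf {n} _ _.

(** Arities that are only provably equal are handled without casts: heads are compared in the
    disjoint union, leaves by numerical position. *)
Lemma flat_eq n m m' (f : O m) (f' : O m') (v : 'I_m -> 'I_n)
    (v' : 'I_m' -> 'I_n) :
  Tagged O f = Tagged O f' ->
  (forall (i : 'I_m) (i' : 'I_m'), i = i' :> nat -> v i = v' i') ->
  Flat f v = Flat f' v'.
Proof.
move=> ff'; have /= e := congr1 tag ff'; case: m' / e f' ff' v' => f'.
move=> /(@eq_from_Tagged _ O)-> v' vv'; congr Flat.
by apply: functional_extensionality => i; apply: vv'.
Qed.

(** The inverse on the leaves is forced by the action axiom: both flats must denote the same
    term. *)
Definition flat_act n (x : flat n) (sigma : 'S_(ar x)) : flat n :=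
  Flat (oact sigma (head x)) (leaf x \o sigma^-1%g).

Definition flat_equiv n (x y : flat n) : Prop :=
  exists sigma, y = @flat_act n x sigma.

Definition flat_comp n k (x : 'I_k -> flat n) (f : O k) : flat n :=
  @Flat n _ (ocomp (fun i => head (x i)) f)
    (fun p => leaf (x (tagnat.sig1 p)) (tagnat.sig2 p)).

Definition flat_var n (i : 'I_n) : flat n := Flat ounit (fun _ : 'I_1 => i).

(** Simultaneous substitution, carried out on flattened terms. *)
Definition flat_bind n m (x : flat n) (y : 'I_n -> flat m) : flat m :=
  flat_comp (y \o leaf x) (head x).

Fixpoint flatten n (t : term O n) : flat n :=
  match t with
  | Var i => flat_var i
  | App _ f a => flat_comp (fun j => flatten (a j)) f
  end.

Lemma flat_equiv_refl n (x : flat n) : flat_equiv x x.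
Proof.
case: x => m f v; exists 1%g; apply: flat_eq => /=; first by rewrite oact_id.
by move=> i i' /val_inj->; rewrite /= invg1 perm1.
Qed.

Lemma flat_equiv_sym n (x y : flat n) : flat_equiv x y -> flat_equiv y x.
Proof.
case: x => m f v [sigma ->]; exists (sigma^-1)%g; apply: flat_eq => /=.
  by rewrite oact_comp mulgV oact_id.
by move=> i i' /val_inj->; rewrite /= invgK permK.
Qed.

Lemma flat_equiv_trans n (x y z : flat n) :
  flat_equiv x y -> flat_equiv y z -> flat_equiv x z.
Proof.
case: x => m f v [sigma ->] [tau ->] /=; exists (sigma * tau)%g.
apply: flat_eq => /=; first by rewrite oact_comp.
by move=> i i' /val_inj->; rewrite /= invMg permM.
Qed.

Lemma leaf_comp n k (x : 'I_k -> flat n) (f : O k) i (r : 'I_(ar (x i))) :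
  leaf (flat_comp x f) (tagnat.Rank i r) = leaf (x i) r.
Proof. by rewrite /= /tagnat.sig2 /tagnat.sig1 tagnat.rankK. Qed.

(** Equivariance of operadic composition, with the leaves tracked. Taking [tau] trivial makes
    composition a congruence; taking [sigma] trivial makes substitution invariant. *)
Lemma flat_comp_act n k (x : 'I_k -> flat n) (f : O k)
    (sigma : forall i, 'S_(ar (x i))) (tau : 'S_k) :
  flat_equiv (flat_comp (x \o tau) f)
             (flat_comp (fun i => flat_act (sigma i)) (oact tau f)).
Proof.
exists (block_perm sigma tau); apply: flat_eq; first exact: oact_ocomp.
move=> p p' /=; rewrite -[p'](permKV (block_perm sigma tau)).
move: ((block_perm sigma tau)^-1 p')%g => q; rewrite permK permE.
elim/Rank_ind: q => i r; rewrite block_fun_Rank => /val_inj->.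
apply: (etrans (leaf_comp (x := fun i => flat_act (sigma i)) (oact tau f) _)).
by rewrite /= permK; apply/esym/(leaf_comp (x := x \o tau) f).
Qed.

Lemma flat_comp_equiv n k (x y : 'I_k -> flat n) (f : O k) :
  (forall i, flat_equiv (x i) (y i)) ->
  flat_equiv (flat_comp x f) (flat_comp y f).
Proof.
move=> xy; have [sigma ys] : exists sigma : forall i, 'S_(ar (x i)),
    y = fun i => flat_act (sigma i).
  exists (fun i => proj1_sig (constructive_indefinite_description _ (xy i))).
  apply: functional_extensionality => i.
  by case: constructive_indefinite_description.
have := flat_comp_act f sigma 1; rewrite oact_id -ys.
congr (flat_equiv (flat_comp _ f) _).
by apply: functional_extensionality => i /=; rewrite perm1.
Qed.

Lemma flat_bind_act n m (x : flat n) (y : 'I_n -> flat m)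
    (sigma : 'S_(ar x)) :
  flat_equiv (flat_bind (flat_act sigma) y) (flat_bind x y).
Proof.
apply: flat_equiv_sym; pose z := y \o leaf (flat_act sigma).
have := flat_comp_act (x := z) (head x) (fun=> 1%g) sigma.
have -> : z \o sigma = y \o leaf x.
  by apply: functional_extensionality => i; rewrite /z /= permK.
suff -> : (fun i => @flat_act _ (z i) 1%g) = z by [].
apply: functional_extensionality => i; case: (z i) => k f v.
apply: flat_eq => /=; first by rewrite oact_id.
by move=> j j' /val_inj->; rewrite /= invg1 perm1.
Qed.

Lemma flat_comp_var n m (f : O m) (v : 'I_m -> 'I_n) :
  flat_comp (fun i => flat_var (v i)) f = Flat f v.
Proof.
apply: flat_eq => [|p i pi] /=; first exact: ocomp_unitl.
congr v; apply: val_inj; rewrite [RHS]/= -pi -[in RHS](tagnat.sig2K p).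
by rewrite Rank_units.
Qed.

Lemma flat_var_bind n m (i : 'I_n) (y : 'I_n -> flat m) :
  flat_bind (flat_var i) y = y i.
Proof.
rewrite /flat_bind /flat_comp /=; case: (y i) => k f v.
apply: flat_eq => [|p j pj] /=; first exact: ocomp_unitr.
congr v; apply: val_inj; rewrite [RHS]/= -pj -[in RHS](tagnat.sig2K p).
by rewrite Rank_single.
Qed.

(** Heads agree by associativity of the operad, leaves by [Rank_assoc]. *)
Lemma flat_bind_comp n m k (x : 'I_k -> flat n) (f : O k) (y : 'I_n -> flat m) :
  flat_bind (flat_comp x f) y = flat_comp (fun j => flat_bind (x j) y) f.
Proof.
apply/esym/flat_eq.
  exact: (ocomp_assoc (fun i j => head (y (leaf (x i) j)))).
move=> p p'; elim/Rank_ind: p' => q r pq.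
have {p pq}-> : p = tagnat.Rank (tagnat.sig1 q)
    (@tagnat.Rank _ (fun j => ar (y (leaf (x (tagnat.sig1 q)) j)))
      (tagnat.sig2 q) r).
  apply: val_inj; rewrite [LHS]pq; apply/esym.
  exact: (@Rank_assoc _ _ (fun i j => ar (y (leaf (x i) j))) q r).
rewrite [RHS](@leaf_comp _ _ (y \o leaf (flat_comp x f))
  (head (flat_comp x f))).
rewrite [LHS](@leaf_comp _ _ (fun j => flat_bind (x j) y) f).
exact: (@leaf_comp _ _ (y \o leaf (x (tagnat.sig1 q)))
  (head (x (tagnat.sig1 q)))).
Qed.

Lemma flatten_subst n m (s : 'I_n -> term O m) (t : term O n) :
  flatten (subst s t) = flat_bind (flatten t) (fun i => flatten (s i)).
Proof.
elim: t => [i|k f a IHa] /=; first by rewrite flat_var_bind.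
rewrite flat_bind_comp; congr flat_comp.
exact: functional_extensionality.
Qed.

(** The unit and composition axioms flatten to equal results; only the action axiom calls for a
    nontrivial permutation. *)
Lemma flatten_sound n (t u : term O n) :
  Pa_obj O |- t =~ u -> flat_equiv (flatten t) (flatten u).
Proof.
elim=> {n t u} [n t u ax|n t|n t u _|n t u v _ IH1 _ IH2|n k f a b _ IH
  |n m s t u _].
- case: ax => {n t u} [|k n fs f|n sigma f] /=; rewrite !flat_comp_var.
  + rewrite (_ : flat_var _ = Flat ounit id); first exact: flat_equiv_refl.
    by congr Flat; apply: functional_extensionality => i; rewrite ord1.
  + under [fun i => flat_comp _ _]functional_extensionality => i
      do rewrite flat_comp_var.
    rewrite (_ : flat_comp _ _ = Flat (ocomp fs f) id).
      exact: flat_equiv_refl.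
    apply: flat_eq => // p p' /val_inj->; exact: tagnat.sig2K.
  + exists sigma; apply: flat_eq => // i i' /val_inj->.
    by rewrite /= permKV.
- exact: flat_equiv_refl.
- exact: flat_equiv_sym.
- exact: flat_equiv_trans IH1 IH2.
- exact: flat_comp_equiv.
- case=> sigma tu; rewrite !flatten_subst tu.
  exact/flat_equiv_sym/flat_bind_act.
Qed.

Lemma Pa_conservative n (f g : O n) :
  Pa_obj O |- App f Var =~ App g Var -> f = g.
Proof.
move/flatten_sound => /=; rewrite !flat_comp_var => -[sigma fg].
(* Head and leaves are paired in one family over the arity, so that a single injectivity step yields
   both equations for the same [sigma]. *)
pose T m := (O m * ('I_m -> 'I_n))%type.
have := congr1 (fun x : flat n => Tagged T (head x, leaf x)) fg.
move=> /= /(@eq_from_Tagged _ T) [-> vs].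
suff -> : sigma = 1%g by rewrite oact_id.
apply/permP => i; move/(congr1 (fun v => v (sigma i))): vs => /=.
by rewrite perm1 permK.
Qed.

Lemma Pa_flatten n (t : term O n) :
  Pa_obj O |- t =~ App (head (flatten t)) (Var \o leaf (flatten t)).
Proof.
elim: t => [i|k f a IHa] /=.
  exact: prov_sym (prov_subst (fun=> Var i) (prov_ax (oax_unit O))).
apply: (prov_trans (prov_app f IHa)).
pose x j := flatten (a j).
have := prov_subst (Var \o leaf (flat_comp x f))
  (prov_ax (oax_comp (fun j => head (x j)) f)).
rewrite /=; congr provable; congr App; apply: functional_extensionality => j.
congr App; apply: functional_extensionality => r; congr Var.
exact: leaf_comp.
Qed.

Lemma operad_axiom_linear n (t u : term O n) :
  operad_axiom t u -> linear_regular_term t /\ linear_regular_term u.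
Proof.
case=> {n t u} [|k n fs f|n sigma f].
- split=> [|i]; first exact: linear_regular_app.
  by rewrite /= [i]ord1.
- split; last exact: linear_regular_app.
  apply: (@linear_regular_graft _ _ _ (fun i => App (fs i) Var) (App f Var));
    move=> *; exact: linear_regular_app.
- split; last exact: linear_regular_app.
  exact: (linear_regular_perm sigma (linear_regular_app f)).
Qed.

Lemma Pa_occurrences : preserves_occurrences (Pa_obj O).
Proof.
move=> n t u; exact: (provable_occurrences operad_axiom_linear).
Qed.

(** Preservation of counts makes the leaf map of the flattening bijective, and the action axiom
    moves it into the operation. *)
Lemma Pa_linear_normal n (t : term O n) : linear_regular_term t ->
  exists f : O n, Pa_obj O |- t =~ App f Var.
Proof.
move=> lt; have := Pa_flatten t; case: (flatten t) => m f v /= tf.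
have v1 i : \sum_(j < m) (i == v j) = 1.
  by rewrite -(lt i) (Pa_occurrences tf).
have e := count1_eq v1; case: n / e in t lt v tf v1 *.
exists (oact (perm (count1_inj v1)) f); apply: (prov_trans tf).
have := prov_ax (oax_act (perm (count1_inj v1)) f).
congr provable; congr App; apply: functional_extensionality => i.
by rewrite permE.
Qed.

End Flattening.

(** * Linear-regular interpretations *)

Section LinearInterpretations.

Lemma occurrences_extend0 L L' (I : forall k, L k -> term L' k) n
    (t : term L n) (i : 'I_n) :
  occurrences i t = 0 -> occurrences i (extend I t) = 0.
Proof.
elim: t => [j|k f a IHa] //= /eqP; rewrite sum_nat_eq0 => /forallP a0.
rewrite occurrences_subst big1 // => j _.
by rewrite IHa ?muln0 //; apply/eqP/(a0 j).
Qed.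

Lemma leq_occurrences_extend L L' (I : forall k, L k -> term L' k) n
    (t : term L n) (i : 'I_n) :
  (forall k (f : L k) j, 0 < occurrences j (I k f)) ->
  occurrences i t <= occurrences i (extend I t).
Proof.
move=> I0; elim: t => [j|k f a IHa] //=.
rewrite occurrences_subst; apply: leq_sum => j _.
exact: leq_trans (IHa j) (leq_pmull _ (I0 k f j)).
Qed.

(* [J] cannot drop a variable of any [J g], since [I (J g)] is provably [g]:  *)
(* so occurrences in [I f] are at most those in [J (I f)], which is [f].      *)
Lemma iso_linear_regular (T T' : theory) (I : @hom ET T T') :
  preserves_occurrences T -> preserves_occurrences T' -> is_iso I ->
  linear_regular_interp I.
Proof.
move=> pT pT' [J [JI IJ]] n f i.
have J0 k (g : symb T' k) j : 0 < occurrences j ((J : interpretation _ _) k g).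
  rewrite lt0n; apply/negP => /eqP.
  move/(occurrences_extend0 (I : interpretation _ _)).
  by rewrite (pT' _ _ _ (IJ k g)) linear_regular_app.
have JI1 := etrans (pT _ _ _ (JI n f) i) (linear_regular_app f i).
apply/eqP; rewrite eqn_leq -{1}JI1 (leq_occurrences_extend _ _ J0) lt0n.
(* Lower bound: a variable missing from [I f] would also be missing from [J (I f)], where it occurs
   once. *)
apply/negP => /eqP/(occurrences_extend0 (J : interpretation _ _)).
by rewrite [X in X = _]JI1.
Qed.

(** Normal forms provide the values of [h]. Since [I] respects each family of axioms,
    [Pa_conservative] turns the images of the axioms into the morphism laws. *)
Lemma Pa_full_linear (O O' : operad)
    (I : interpretation (Pa_obj O) (Pa_obj O')) :
  linear_regular_interp I ->
  exists h : operad_hom O O', interp_heq (Pa_mor h) I.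
Proof.
move=> lI; pose ex n (f : O n) := Pa_linear_normal (lI n f).
pose h n f := proj1_sig (constructive_indefinite_description _ (ex n f)).
have hI n f : Pa_obj O' |- App (h n f) Var =~ I n f.
  by rewrite /h; case: constructive_indefinite_description => g /= /prov_sym.
have hax n (t u : term O n) : operad_axiom t u ->
    Pa_obj O' |- extend (fun k f => App (h k f) Var) t
              =~ extend (fun k f => App (h k f) Var) u.
  move=> tu; apply: prov_trans (prov_extend_heq t hI) _.
  apply: prov_trans (prov_sym (prov_extend_heq u hI)).
  exact: (prov_extend I (prov_ax tu)).
have h1 : h 1 ounit = ounit.
  apply: Pa_conservative; apply: prov_trans (hax _ _ _ (oax_unit O)) _.
  exact: prov_sym (prov_ax (oax_unit O')).
have hcomp k (n : 'I_k -> nat) (fs : forall i, O (n i)) (f : O k) :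
    h _ (ocomp fs f) = ocomp (fun i => h _ (fs i)) (h _ f).
  apply: Pa_conservative.
  apply: prov_trans (prov_sym (hax _ _ _ (oax_comp fs f))) _.
  exact: prov_ax (oax_comp _ _).
have hact n (sigma : 'S_n) (f : O n) : h _ (oact sigma f) = oact sigma (h _ f).
  apply: Pa_conservative.
  apply: prov_trans (prov_sym (hax _ _ _ (oax_act sigma f))) _.
  exact: prov_ax (oax_act _ _).
by exists (OperadHom h1 hcomp hact).
Qed.

Lemma Pa_linear_regular (O : operad) : linear_regular_theory (Pa_obj O).
Proof.
move=> n t u; apply: provable_weaken => {}n {}t {}u tu; apply: prov_ax.
by have [lt lu] := operad_axiom_linear tu; split=> //; exact: prov_ax.
Qed.

(** If t is provably f(x_1, ..., x_n), then permuting its variables by [tau] gives the operation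
    [oact tau f]; conservativity then makes [tau] fix f. *)
Lemma Pa_rigid (O : operad) : rigid_operad O -> rigid_theory (Pa_obj O).
Proof.
move=> rO; split=> [|n t tau lt ttau]; first exact: Pa_linear_regular.
have [f tf] := Pa_linear_normal lt; apply/(rO _ f)/Pa_conservative.
apply: prov_trans (prov_sym (prov_ax (oax_act tau f))) _.
apply: prov_trans (prov_trans (prov_sym ttau) tf).
exact: prov_sym (prov_subst _ tf).
Qed.

Lemma Pa_faithful (O O' : operad) (h h' : operad_hom O O') :
  interp_heq (Pa_mor h) (Pa_mor h') -> operad_heq h h'.
Proof. by move=> hh' n f; exact: Pa_conservative (hh' n f). Qed.

Lemma Pa_mor_linear (O O' : operad) (h : operad_hom O O') :
  linear_regular_interp (Pa_mor h).
Proof. by move=> n f; exact: linear_regular_app. Qed.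

(** The inverse is linear-regular as well, so both directions lift, and faithfulness makes the lifts
    mutually inverse. *)
Lemma Pa_full_on_isos (O O' : operad)
    (I : interpretation (Pa_obj O) (Pa_obj O')) :
  @is_iso ET _ _ I ->
  exists h : operad_hom O O', @is_iso SOp _ _ h /\ interp_heq (Pa_mor h) I.
Proof.
move=> isoI; have [J [JI IJ]] := isoI.
have lI := iso_linear_regular (@Pa_occurrences O) (@Pa_occurrences O') isoI.
have [h hI] := Pa_full_linear lI.
have isoJ : @is_iso ET _ _ J by exists I.
have lJ := iso_linear_regular (@Pa_occurrences O') (@Pa_occurrences O) isoJ.
have [g gJ] := Pa_full_linear lJ.
exists h; split=> //; exists g; split; apply: Pa_faithful.
  exact: (heq_trans (comp_heq (c := ET) gJ hI) JI).
exact: (heq_trans (comp_heq (c := ET) hI gJ) IJ).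
Qed.

End LinearInterpretations.

(** * The operad of linear-regular terms *)

Section GraftIdentities.
Variable L : nat -> Type.

Lemma graft_assoc k (m : 'I_k -> nat) (n : forall i, 'I_(m i) -> nat)
    (g : forall i j, term L (n i j)) (f : forall i, term L (m i)) (h : term L k)
    (e : \sum_i \sum_j n i j = \sum_p n (tagnat.sig1 p) (tagnat.sig2 p)) :
  subst (fun p => Var (cast_ord e p)) (graft (fun i => graft (g i) (f i)) h) =
  graft (fun p => g (tagnat.sig1 p) (tagnat.sig2 p)) (graft f h).
Proof.
rewrite /graft !subst_subst; apply: eq_subst => i.
rewrite !subst_subst; apply: eq_subst => j /=; rewrite subst_subst /=.
(* The inner term as a function of the pair [(i, j)], again so that [rankK] applies by
   congruence. *)
pose G (s : {i & 'I_(m i)}) :=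
  subst (fun r => Var (cast_ord e
    (@tagnat.Rank _ (fun i => \sum_j n i j) (tag s)
      (@tagnat.Rank _ (n (tag s)) (tagged s) r)))) (g (tag s) (tagged s)).
apply: etrans (esym (congr1 G (tagnat.rankK (Tagged _ j)))) _.
apply: eq_subst => r; congr Var; apply: val_inj.
exact: (@Rank_assoc _ _ n (tagnat.Rank i j) r).
Qed.

Lemma graft_perm k (n : 'I_k -> nat) (sigma : forall i, 'S_(n i)) (tau : 'S_k)
    (fs : forall i, term L (n i)) (f : term L k) :
  subst (fun p => Var (cast_ord (sum_perm_eq n tau) p))
    (graft (fun i => perm_term (sigma i) (fs i)) (perm_term tau f)) =
  perm_term (block_perm sigma tau) (graft (fun i => fs (tau i)) f).
Proof.
rewrite /graft /perm_term !subst_subst; apply: eq_subst => i /=.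
rewrite !subst_subst; apply: eq_subst => r /=.
by rewrite permE block_fun_Rank.
Qed.

End GraftIdentities.

Section SyntacticOperad.
Variable T : theory.
Let L := symb T.

Definition canon n (t : term L n) : term L n :=
  epsilon (inhabits t) (fun u => linear_regular_term u /\ T |- t =~ u).

Lemma canonP n (t : term L n) : linear_regular_term t ->
  linear_regular_term (canon t) /\ T |- t =~ canon t.
Proof.
move=> lt; apply: (epsilon_spec (inhabits t)
  (fun u => linear_regular_term u /\ T |- t =~ u)).
by exists t; split=> //; exact: prov_refl.
Qed.

(** Provably equal terms define extensionally the same predicate, so [epsilon] makes the same choice
    for both. *)
Lemma eq_canon n (t u : term L n) : T |- t =~ u -> canon t = canon u.
Proof.
move=> tu; rewrite /canon.
rewrite (Classical_Prop.proof_irrelevance _ (inhabits t) (inhabits u)).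
congr epsilon; apply: functional_extensionality => w.
apply: propositional_extensionality.
split=> -[lw uw]; split=> //; apply: prov_trans uw => //; exact: prov_sym.
Qed.

(* Classes of linear-regular terms modulo provability, as the terms fixed by  *)
(* a choice of representatives.                                               *)
Record lr_class n := LrClass {
  rep : term L n;
  rep_linear : linear_regular_term rep;
  rep_canon : canon rep = rep
}.

Lemma lr_class_eq n (x y : lr_class n) : T |- rep x =~ rep y -> x = y.
Proof.
move=> /eq_canon; rewrite !rep_canon; case: x y => [t lt ct] [u lu cu] /= tu.
case: u / tu lu cu => lu cu.
by congr LrClass; exact: Classical_Prop.proof_irrelevance.
Qed.

Definition class_of n (t : term L n) (lt : linear_regular_term t) :
    lr_class n :=
  LrClass (canonP lt).1 (esym (eq_canon (canonP lt).2)).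

Lemma rep_class n (t : term L n) (lt : linear_regular_term t) :
  T |- rep (class_of lt) =~ t.
Proof. exact: prov_sym (canonP lt).2. Qed.

Lemma Tagged_lr_class m n (e : m = n) (x : lr_class m) (y : lr_class n) :
  T |- subst (fun i => Var (cast_ord e i)) (rep x) =~ rep y ->
  Tagged lr_class x = Tagged lr_class y.
Proof.
case: n / e y => y xy; congr Tagged; apply: lr_class_eq.
apply: prov_trans xy; rewrite -[X in provable _ X](subst_var (rep x)).
by rewrite [X in provable _ _ X](_ : _ = subst Var (rep x));
  [exact: prov_refl | apply: eq_subst => i; rewrite cast_ord_id].
Qed.

Lemma linear_regular_var (i : 'I_1) : linear_regular_term (@Var L 1 i).
Proof. by move=> j; rewrite /= [i]ord1 [j]ord1. Qed.

Definition lr_unit : lr_class 1 := class_of (linear_regular_var ord0).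

Definition lr_comp k (n : 'I_k -> nat) (fs : forall i, lr_class (n i))
    (f : lr_class k) : lr_class (\sum_i n i) :=
  class_of (linear_regular_graft (fun i => rep_linear (fs i)) (rep_linear f)).

Definition lr_act n (sigma : 'S_n) (f : lr_class n) : lr_class n :=
  class_of (linear_regular_perm sigma (rep_linear f)).

Lemma prov_graft k (n : 'I_k -> nat) (fs gs : forall i, term L (n i))
    (f g : term L k) :
  (forall i, T |- fs i =~ gs i) -> T |- f =~ g ->
  T |- graft fs f =~ graft gs g.
Proof. by move=> fgs; apply: prov_subst2 => i; exact: prov_subst. Qed.

Lemma lr_unitl n (f : lr_class n) :
  Tagged lr_class (lr_comp (fun _ : 'I_n => lr_unit) f) = Tagged lr_class f.
Proof.
have e : \sum_(i < n) 1 = n by rewrite sum1_card card_ord.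
apply: (Tagged_lr_class (e := e)).
apply: prov_trans (prov_subst _ (rep_class _)) _.
apply: (prov_trans (prov_subst _
  (prov_graft (fun=> rep_class _) (prov_refl _ _)))).
rewrite subst_subst /= (eq_subst (s' := Var)) ?subst_var.
  exact: prov_refl.
by move=> i; congr Var; apply: val_inj; exact: Rank_units.
Qed.

Lemma lr_unitr n (f : lr_class n) :
  Tagged lr_class (lr_comp (fun _ : 'I_1 => f) lr_unit) = Tagged lr_class f.
Proof.
have e : \sum_(i < 1) n = n by rewrite big_ord1.
apply: (Tagged_lr_class (e := e)).
apply: prov_trans (prov_subst _ (rep_class _)) _.
apply: (prov_trans (prov_subst _
  (prov_graft (fun=> prov_refl _ _) (rep_class _)))).
rewrite subst_subst /= subst_subst -[X in provable _ _ X]subst_var.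
apply: prov_subst_pointwise => i /=.
rewrite [X in provable _ (Var X)](_ : _ = i).
  exact: prov_refl.
by apply: val_inj; exact: Rank_single.
Qed.

Lemma lr_assoc k (m : 'I_k -> nat) (n : forall i, 'I_(m i) -> nat)
    (g : forall i j, lr_class (n i j)) (f : forall i, lr_class (m i))
    (h : lr_class k) :
  Tagged lr_class (lr_comp (fun i => lr_comp (g i) (f i)) h) =
  Tagged lr_class (lr_comp (fun p => g (tagnat.sig1 p) (tagnat.sig2 p))
                           (lr_comp f h)).
Proof.
have e : \sum_i \sum_j n i j = \sum_p n (tagnat.sig1 p) (tagnat.sig2 p).
  rewrite [RHS](reindex (@tagnat.rank k m)) /=;
    last exact: onW_bij tagnat.rank_bij.
  rewrite (sig_big_dep xpredT (fun _ _ => true) n).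
  by apply: eq_bigr => s _; rewrite /tagnat.sig1 /tagnat.sig2 tagnat.rankK.
apply: (Tagged_lr_class (e := e)).
apply: prov_trans (prov_subst _ (rep_class _)) _.
apply: (prov_trans (prov_subst _
  (prov_graft (fun=> rep_class _) (prov_refl _ _)))).
apply: prov_trans (prov_sym (rep_class _)).
apply: prov_trans (prov_graft (fun=> prov_refl _ _) (prov_sym (rep_class _))).
rewrite (graft_assoc (fun i j => rep (g i j)) (fun i => rep (f i))).
exact: prov_refl.
Qed.

Lemma lr_act_comp k (n : 'I_k -> nat) (sigma : forall i, 'S_(n i))
    (tau : 'S_k) (fs : forall i, lr_class (n i)) (f : lr_class k) :
  Tagged lr_class (lr_comp (fun i => lr_act (sigma i) (fs i)) (lr_act tau f)) =
  Tagged lr_class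
    (lr_act (block_perm sigma tau) (lr_comp (fun i => fs (tau i)) f)).
Proof.
apply: (Tagged_lr_class (e := sum_perm_eq n tau)).
apply: prov_trans (prov_subst _ (rep_class _)) _.
apply: (prov_trans (prov_subst _
  (prov_graft (fun=> rep_class _) (rep_class _)))).
apply: prov_trans (prov_sym (rep_class _)).
apply: prov_trans (prov_subst _ (prov_sym (rep_class _))).
rewrite (graft_perm sigma tau (fun i => rep (fs i))).
exact: prov_refl.
Qed.

Lemma lr_act_id n (f : lr_class n) : lr_act 1 f = f.
Proof.
apply: lr_class_eq; apply: prov_trans (rep_class _) _.
rewrite /perm_term (eq_subst (s' := Var)) ?subst_var; first exact: prov_refl.
by move=> i; rewrite perm1.
Qed.

Lemma lr_act_act n (sigma tau : 'S_n) (f : lr_class n) :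
  lr_act sigma (lr_act tau f) = lr_act (tau * sigma)%g f.
Proof.
apply: lr_class_eq; apply: prov_trans (rep_class _) _.
apply: prov_trans (prov_sym (rep_class _)).
apply: (prov_trans (prov_subst _ (rep_class _))).
rewrite /perm_term subst_subst /=.
rewrite (eq_subst (s' := fun i => Var ((tau * sigma)%g i))) => [|i].
  exact: prov_refl.
by rewrite permM.
Qed.

Definition lr_operad : operad :=
  Operad lr_unitl lr_unitr lr_assoc lr_act_id lr_act_act lr_act_comp.

Lemma lr_operad_rigid : rigid_theory T -> rigid_operad lr_operad.
Proof.
move=> [_ rT] n f sigma sf; apply: (rT _ _ _ (rep_linear f)).
by rewrite -[X in provable _ (rep X)]sf; exact: rep_class.
Qed.

Lemma eval_opsP n (t u : term lr_operad n) : operad_axiom t u ->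
  T |- extend (@rep) t =~ extend (@rep) u.
Proof.
case=> {n t u} [|k n fs f|n sigma f].
- exact: (prov_trans (prov_subst_var _ _) (rep_class _)).
- apply: prov_sym; exact: prov_trans (prov_subst_var _ _) (rep_class _).
- apply: prov_sym; exact: prov_trans (prov_subst_var _ _) (rep_class _).
Qed.

Definition eval_ops : interpretation (Pa_obj lr_operad) T :=
  @Interpretation (Pa_obj lr_operad) T (@rep) eval_opsP.

Definition symb_op k (g : L k) : term lr_operad k :=
  App (class_of (linear_regular_app g) : lr_operad k) Var.

Lemma eval_symb_op n (t : term L n) :
  T |- extend eval_ops (extend symb_op t) =~ t.
Proof.
apply: prov_trans (prov_sym (prov_extend_extend _ _ _ _)) _.
apply: prov_trans (prov_extend_id _ t); apply: prov_extend_heq => k g.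
exact: prov_trans (prov_subst_var _ _) (rep_class _).
Qed.

(** The translated term is linear-regular, hence provably some f(x_1, ..., x_n). Evaluating back in
    [T] shows that f represents the class of [t]. *)
Lemma symb_op_class n (t : term L n) (lt : linear_regular_term t) :
  Pa_obj lr_operad |- extend symb_op t =~ App (class_of lt : lr_operad n) Var.
Proof.
have : linear_regular_term (extend symb_op t).
  move=> i; rewrite occurrences_extend // => k f; exact: linear_regular_app.
case/Pa_linear_normal => f tf; suff <- : f = class_of lt by [].
apply: lr_class_eq; apply: prov_trans (prov_sym (rep_class lt)).
apply: prov_trans (eval_symb_op t).
apply: prov_trans (prov_sym (prov_extend eval_ops tf)).
exact: prov_sym (prov_subst_var _ _).
Qed.

Lemma symb_op_linear_consequence n (t u : term L n) :
  linear_regular_consequences t u ->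
  Pa_obj lr_operad |- extend symb_op t =~ extend symb_op u.
Proof.
move=> [tu lt lu]; apply: prov_trans (symb_op_class lt) _.
apply: prov_trans (prov_sym (symb_op_class lu)).
suff -> : class_of lt = class_of lu by exact: prov_refl.
apply: lr_class_eq; apply: prov_trans (rep_class _) _.
exact: prov_trans tu (prov_sym (rep_class _)).
Qed.

Hypothesis linT : linear_regular_theory T.

(** An axiom of [T] may fail to be linear-regular, but by [linT] it follows from linear-regular
    consequences, which [symb_op] respects. *)
Lemma name_symbP n (t u : term L n) : axiom_of T t u ->
  Pa_obj lr_operad |- extend symb_op t =~ extend symb_op u.
Proof.
pose T0 := Theory (@linear_regular_consequences T).
pose I0 := @Interpretation T0 (Pa_obj lr_operad) _ symb_op_linear_consequence.
move=> /prov_ax/linT tu; exact: (@prov_extend T0 _ I0 n t u tu).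
Qed.

Definition name_symb : interpretation T (Pa_obj lr_operad) :=
  Interpretation name_symbP.

Lemma eval_opsK : interp_heq (interp_comp name_symb eval_ops) (interp_id _).
Proof.
move=> n f; apply: prov_trans (symb_op_class (rep_linear f)) _.
rewrite /= (_ : class_of _ = f); first exact: prov_refl.
exact/lr_class_eq/rep_class.
Qed.

Lemma name_symbK : interp_heq (interp_comp eval_ops name_symb) (interp_id T).
Proof. by move=> n g; exact: prov_trans (prov_subst_var _ _) (rep_class _). Qed.

End SyntacticOperad.

(** * Corestriction to rigid theories and conclusion *)

Lemma linear_regular_interp_mor (T T' : theory) (I : interpretation T T') :
  linear_regular_interp I -> linear_regular_mor I.
Proof. by exists I => // n f; exact: prov_refl. Qed.

Definition Pp_obj (O : RiOp) : subcat RiET_in_ET :=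
  @SubObj ET RiET_in_ET (Pp O)
    (conj (@Pa_linear_regular _) (Pa_rigid (sub_objP O))).

Definition Pp_mor (O O' : RiOp) (h : hom O O') : hom (Pp_obj O) (Pp_obj O') :=
  @SubHom ET RiET_in_ET (Pp_obj O) (Pp_obj O') (fmor Pp h)
    (linear_regular_interp_mor (@Pa_mor_linear _ _ _)).

Definition Pp_corestriction : functor RiOp (subcat RiET_in_ET) :=
  @Functor RiOp (subcat RiET_in_ET) Pp_obj Pp_mor (@fmor_heq _ _ Pp)
    (@fmor_id _ _ Pp) (@fmor_comp _ _ Pp).

Theorem proposition6p3 :
  faithful Pp /\ full_on_isos Pp /\ essential_image_is Pp RiET_in_ET.
Proof.
split; [|split].
- by move=> O O' h h'; exact: Pa_faithful.
- move=> O O' I /Pa_full_on_isos[h [[g [gh hg]] hI]].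
  exists (@SubHom _ RiOp_in_SOp O O' h Logic.I); split=> //.
  by exists (@SubHom _ RiOp_in_SOp O' O g Logic.I).
- exists Pp_corestriction; split.
  + move=> O O' [I [J IJ lJ]]; have [h hJ] := Pa_full_linear lJ.
    exists (@SubHom _ RiOp_in_SOp O O' h Logic.I).
    by move=> n f; exact: prov_trans (hJ n f) (prov_sym (IJ n f)).
  + move=> [T [linT rT]].
    exists (@SubObj _ RiOp_in_SOp (lr_operad T) (lr_operad_rigid rT)).
    (* Both comparison maps must be linear-regular, so that the isomorphism lies in the category of
       rigid theories. *)
    unshelve eexists; [|unshelve eexists].
    * exists (eval_ops T); apply: linear_regular_interp_mor => n f.
      exact: rep_linear.
    * exists (name_symb linT); apply: linear_regular_interp_mor => n f.
      exact: linear_regular_app.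
    * by split; [exact: eval_opsK | exact: name_symbK].
  + by exists (fun _ => erefl) => O O' h n f; exact: prov_refl.
Qed.
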